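(* Assume (A$_F$): if $p\in(0,1)$ then $\int_{|u|>1}|u|^pF^M(du)<\infty$. For $y\in\mathbb R^n$ let $\Lambda_-(y):=\{u\in\mathbb R^n\setminus\{0\}:y^\top u<0\}$ and $\Lambda^+(y):=\{u\in\mathbb R^n\setminus\{0\}:y^\top u>0\}$. Let $\psi:\mathbb R^n\to(-\infty,+\infty]$ be the convex function $$\psi(\pi):=\begin{cases}-\pi^\top b^M-\frac{p-1}2\pi^\top c\pi-\{p^{-1}(1+\pi^\top u)^p-p^{-1}-\pi^\top h(u)\}*F^M,&\pi\in C_0,\\+\infty,&\pi\notin C_0,\end{cases}$$ and let $\psi0^+$ be its recession function. Then: (i) If $F^M(\Lambda_-(\pi))=0$, then $\psi0^+(\pi)=\pi^\top(h(u)*F^M-b^M)$ when $c\pi=0$, and $\psi0^+(\pi)=+\infty$ when $c\pi\ne0$. If $F^M(\Lambda_-(\pi))>0$, then $\psi0^+(\pi)=+\infty$. (ii) If $F^M(\Lambda^+(\pi))=0$, then $\psi0^+(-\pi)=-\pi^\top(h(u)*F^M-b^M)$ when $c\pi=0$, and $\psi0^+(-\pi)=+\infty$ when $c\pi\neq0$. If $F^M(\Lambda^+(\pi))>0$, then $\psi0^+(-\pi)=+\infty$. (iii) The recession cone of $\psi$ is $$\{\pi\in\mathbb R^n:\ F^M(\Lambda_-(\pi))=0,\ c\pi=0,\ \pi^\top(h(u)*F^M-b^M)\le0\}.$$ (iv) The constancy space of $\psi$ is $\mathcal N^{Q^M}:=\{\pi\in\mathbb R^n:\ c\pi=0,\ F^M(\{u\in\mathbb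 R^n\setminus\{0\}:\pi^\top u\ne0\})=0,\ \pi^\top b^M=0\}$.
   Context: $p\in(-\infty,0)\cup(0,1)$ is fixed and the truncation function is $h(u)=u\mathbf 1_{\{|u|\le1\}}$. The return process $R$ is an $\mathbb R^n$-valued Lévy process, and $(b^M,c,F^M)$ are its differential characteristics relative to $h$ under an equivalent measure $Q^M$ with local density $\mathcal E(M)$ with respect to the original measure; in this Lévy setting the triple $(b^M,c,F^M)$ is taken deterministic and constant: $b^M\in\mathbb R^n$, $c$ is a symmetric nonnegative definite $n\times n$ matrix, and $F^M$ is a Lévy measure ($F^M(\{0\})=0$, $\int(|u|^2\wedge1)F^M(du)<\infty$). For a function $g$, $g(u)*F^M:=\int g(u)F^M(du)$; expressions $\pi^\top(h(u)*F^M)$ are understood as $\int\pi^\top h(u)F^M(du)$. The budget set is $C_0:=\{\pi\in\mathbb R^n:\ F^M(\{u\in\mathbb R^n\setminus\{0\}:\pi^\top u+1<0\})=0\}$, which is closed, convex and contains $0$. Convex analysis terminology (Rockafellar): the recession function satisfies $\psi0^+(\pi)=\lim_{\lambda\downarrow0}\lambda\psi(\lambda^{-1}\pi)$ (for $\psi$ closed proper convex with $0\in\mathrm{dom}\,\psi$); the recession cone of $\psi$ is $\{\pi:\psi0^+(\pi)\le0\}$; the constancy space is $\{\pi:\psi0^+(\pi)\le0,\ \psi0^+(-\pi)\le0\}$. *)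

(* Defs.v *)
From HB Require Import structures.
From mathcomp Require Import all_boot all_order all_algebra.
From mathcomp Require Import all_classical all_reals all_analysis.
Set Implicit Arguments.
Unset Strict Implicit.
Unset Printing Implicit Defensive.
Import Order.TTheory GRing.Theory Num.Theory.
Import numFieldNormedType.Exports.
Local Open Scope classical_set_scope.
Local Open Scope ring_scope.

(* R^n as column vectors, with the Borel sigma-algebra; the underlying type is
   convertible to 'cV[R]_n. *)
Notation borelRn R n := (g_sigma_algebraType (@open 'cV[R]_n)).

Section ConvexAnalysis.
Variable R : realType.

(* The recession cone 0^+ C of a set C. *)
Definition recession_directions (W : lmodType R) (C : set W) : set W :=
  [set y | forall (x : W) (t : R), C x -> 0 <= t -> C (x + t *: y)].

Variable V : lmodType R.
Implicit Types (f : V -> \bar R) (y : V).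

Definition epigraph f : set (V * R^o)%type :=
  [set z | (f z.1 <= (z.2 : R)%:E)%E].

(* Rockafellar's f0^+: the function whose epigraph is 0^+ (epi f), with value
   +oo at y when no (y, mu) lies in that cone.  For f closed proper convex with
   0 in dom f, it is the limit of l * f (l^-1 *: y) as l decreases to 0. *)
Definition recession_fun f y : \bar R :=
  ereal_inf [set mu%:E |
    mu in [set mu : R | recession_directions (epigraph f) (y, mu : R^o)]].

Definition recession_cone f : set V := [set y | (recession_fun f y <= 0)%E].

Definition constancy_space f : set V :=
  [set y | (recession_fun f y <= 0)%E /\ (recession_fun f (- y) <= 0)%E].

End ConvexAnalysis.

Section LevyTriplet.
Variables (R : realType) (n : nat).
Implicit Types (u x y pi b : 'cV[R]_n) (c : 'M[R]_n).
Implicit Types F : {measure set (borelRn R n) -> \bar R}.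

Definition dot x y : R := \sum_(i < n) x i ord0 * y i ord0.

(* The Euclidean norm: the library norm `|u| on matrices is the sup norm. *)
Definition enorm u : R := Num.sqrt (dot u u).

Definition trunc u : 'cV[R]_n := if enorm u <= 1 then u else 0.

Definition sym_nonneg c : Prop := c^T = c /\ forall x, 0 <= dot x (c *m x).

Definition levy_measure F : Prop :=
  F [set 0] = 0%E /\
  (\int[F]_u (Num.min (enorm u ^+ 2) 1)%:E < +oo)%E.

Definition halfspace_neg y : set (borelRn R n) := [set u | u != 0 /\ dot y u < 0].
Definition halfspace_pos y : set (borelRn R n) := [set u | u != 0 /\ 0 < dot y u].
Definition off_hyperplane y : set (borelRn R n) :=
  [set u | u != 0 /\ dot y u != 0].

Definition budget_set F : set 'cV[R]_n :=
  [set pi | F ([set u | u != 0 /\ dot pi u + 1 < 0] : set (borelRn R n)) = 0%E].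

(* p^-1 x^p as an extended real: for p < 0 its value at 0 is -oo, whereas powR
   returns 0 at base 0.  The value -oo for x < 0 is the usual concave
   extension; for pi in budget_set F it is only met on an F-null set. *)
Definition power_utility (p x : R) : \bar R :=
  if 0 < x then (p^-1 * x `^ p)%:E
  else if (x == 0) && (0 < p) then 0%E
  else -oo%E.

Definition psi (p : R) b c F (pi : 'cV[R]_n) : \bar R :=
  if pi \in budget_set F then
    ((- dot pi b - (p - 1) / 2 * dot pi (c *m pi))%:E
     - \int[F]_u (power_utility p (1 + dot pi u)%R
                  - (p^-1)%:E - (dot pi (trunc u))%:E))%E
  else +oo%E.

(* pi^T (h(u) * F - b); the integral is extended-real valued. *)
Definition drift_diff b F pi : \bar R :=
  (\int[F]_u (dot pi (trunc u))%:E - (dot pi b)%:E)%E.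

Definition null_investments b c F : set 'cV[R]_n :=
  [set pi | [/\ c *m pi = 0, F (off_hyperplane pi) = 0%E & dot pi b = 0]].

Definition p_integrable_tails (p : R) F : Prop :=
  0 < p < 1 ->
  (\int[F]_(u in [set u : borelRn R n | (1 < enorm u)%R]) (enorm u `^ p)%:E
     < +oo)%E.

End LevyTriplet.

(* Main.v *)
Require Import Defs.
From HB Require Import structures.
From mathcomp Require Import all_boot all_order all_algebra.
From mathcomp Require Import all_classical all_reals all_analysis.
From mathcomp Require Import measurable_realfun ring lra.
Import Order.TTheory GRing.Theory Num.Theory.
Import numFieldNormedType.Exports.
Local Open Scope classical_set_scope.
Local Open Scope ring_scope.

(** Write U(y) = y^p / p and g_pi(u) = U(1 + pi.u) - U(1) - pi.h(u) for the
    jump integrand.  Since psi 0 = 0, a slope mu admissible in the direction pi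
    bounds psi along the ray: psi (t pi) <= t mu for all t >= 0.  The three
    terms of psi restrict mu in three ways.

    - Budget set.  If pi.u < 0 with positive F-measure then t pi leaves C_0 for
      large t, so no slope is admissible ([exits_budget_set]).
    - Diffusion.  The integral of g_(t pi) is at most linear in t
      ([integral_jump_gain_le]) whereas - (p-1)/2 t^2 pi.(c pi) is quadratic,
      because p < 1.  So pi.(c pi) <= 0, that is c pi = 0
      ([quad_form_le0_of_linear_ray], [sym_nonneg_ker]).
    - Drift.  Otherwise pi.u >= 0 almost everywhere; as U grows sublinearly,
      - g_(t pi)(u) / t tends to pi.h(u), and Fatou's lemma, applied after
      adding an integrable bound of g_(t pi) / t, gives drift <= mu
      ([drift_diff_le_ray_slope]).

    Conversely, if pi.u >= 0 almost everywhere and c pi = 0, then moving from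
    any x by t pi stays in C_0, keeps the quadratic term, and increases U, so
    that psi (x + t pi) <= psi x + t drift ([psi_add_drift]).  This settles (i).
    The other items follow formally: (ii) is (i) at - pi, since the drift is odd
    as soon as pi.h(u) has a constant sign; (iii) collects the cases of (i); and
    (iv) intersects (iii) with its reflection.

    The estimates on U come from one inequality, its tangent line bound
    ([power_utility_tangent]): at 1 it gives g_pi <= 0 on small jumps, at
    the larger of two points monotonicity, and at a point with small slope
    sublinear growth. *)

Set Implicit Arguments.
Unset Strict Implicit.

(** * Recession functions *)

Section RecessionFunction.
Variables (R : realType) (V : lmodType R).
Implicit Types (f : V -> \bar R) (y : V).

(** Testing the epigraph cone at its point (0, 0) alone already bounds
    admissible slopes by the behaviour of [f] on the ray through [y]. *)
Lemma recession_fun_ge f y (l : \bar R) : (f 0%R <= 0)%E ->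
  (forall mu : R, (forall t : R, 0 <= t -> (f (t *: y)%R <= (t * mu)%:E)%E) ->
    (l <= mu%:E)%E) ->
  (l <= recession_fun f y)%E.
Proof.
move=> f0 h; apply: le_ereal_inf_tmp => _ [mu /= dmu <-].
apply: h => t t0.
have := dmu (0, 0 : R^o) t; rewrite /epigraph /= => /(_ f0 t0).
by rewrite !add0r.
Qed.

Lemma recession_fun_le f y (mu : R) :
  (forall (x : V) (t : R), 0 <= t -> (f x < +oo)%E ->
    (f (x + t *: y)%R <= f x + (t * mu)%:E)%E) ->
  (recession_fun f y <= mu%:E)%E.
Proof.
move=> h; apply: ereal_inf_lbound; exists mu => //= -[x r] t /= xr t0.
have := h x t t0 (le_lt_trans xr (ltry _)) => /le_trans; apply.
by rewrite EFinD leeD2r.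
Qed.

End RecessionFunction.

(** * Power utility *)

Section PowerUtility.
Variables (R : realType) (p : R).
Hypothesis hp : p < 0 \/ 0 < p < 1.

Let p_neq0 : p != 0.
Proof. by case: hp => [/lt_eqF->//|/andP[/gt_eqF->]]. Qed.

(** In the variable s = ln y this is 1 + s <= e^s.  For p < 0 that bound at s
    and at p s suffices; for 0 < p < 1 the claim is the convexity inequality
    e^(p s) <= (1 - p) e^0 + p e^s, where e^0 and e^s are compared with
    e^(p s). *)
Lemma powR_bernoulli (y : R) : 0 < y -> p^-1 * y `^ p <= p^-1 + (y - 1).
Proof.
move=> y0; rewrite /powR gt_eqF//.
have -> : y = expR (ln y) by rewrite lnK.
move: (ln y) => s; rewrite expRK => {y y0}.
case: hp => [p0|/andP[p0 p1]].
- have e1 := expR_ge1Dx s; have e2 := expR_ge1Dx (p * s).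
  have ip : p^-1 < 0 by rewrite invr_lt0.
  have : p^-1 * expR (p * s) <= p^-1 * (1 + p * s) by rewrite ler_nM2l.
  by rewrite mulrDr mulr1 mulrA mulVf// mul1r; lra.
- have E1 : expR s = expR (p * s) * expR ((1 - p) * s).
    by rewrite -expRD; congr expR; ring.
  have E2 : 1 = expR (p * s) * expR (- (p * s)) :> R.
    by rewrite -expRD subrr expR0.
  have e1 := expR_ge1Dx ((1 - p) * s); have e2 := expR_ge1Dx (- (p * s)).
  have e0 : 0 < expR (p * s) := expR_gt0 _.
  suff : expR (p * s) <= 1 + p * (expR s - 1).
    move=> h; have : p^-1 * expR (p * s) <= p^-1 * (1 + p * (expR s - 1)).
      by rewrite ler_pM2l// invr_gt0.
    by rewrite mulrDr mulr1 mulrA mulVf// mul1r.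
  have -> : 1 + p * (expR s - 1) = (1 - p) * 1 + p * expR s by ring.
  have h : expR (p * s) * ((1 - p) * (1 - p * s) + p * (1 + (1 - p) * s)) <=
           expR (p * s) * ((1 - p) * expR (- (p * s)) + p * expR ((1 - p) * s)).
    by rewrite ler_pM2l// lerD// ler_pM2l// subr_gt0.
  rewrite E1 {2}E2; set a := expR (p * s) in e0 h *.
  apply: le_trans (le_trans _ h) _; rewrite le_eqVlt; apply/orP; left.
    by apply/eqP; ring.
  by apply/eqP; ring.
Qed.

(** The case a = 1 is Bernoulli's inequality, and homogeneity reduces to it.
    The point y = 0 with p > 0, where the utility is 0, is separate. *)
Lemma power_utility_tangent (a y : R) : 0 < a ->
  (power_utility p y <= (p^-1 * a `^ p + a `^ (p - 1) * (y - a))%:E)%E.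
Proof.
move=> a0; have ap : 0 < a `^ p by rewrite powR_gt0.
have -> : a `^ (p - 1) = a `^ p / a.
  rewrite powRB ?powRr1//; first exact: ltW.
  by apply/implyP => _; rewrite gt_eqF.
rewrite /power_utility; case: ifPn => [y0|].
  rewrite lee_fin; have ya : 0 < y / a by rewrite divr_gt0.
  have := powR_bernoulli ya.
  have -> : y `^ p = a `^ p * (y / a) `^ p.
    by rewrite -powRM ?ltW// mulrC divfK// gt_eqF.
  set w := (y / a) `^ p; set v := a `^ p.
  have -> : p^-1 * v + v / a * (y - a) = v * (p^-1 + (y / a - 1)).
    by field; rewrite p_neq0 gt_eqF.
  by rewrite [X in _ -> X <= _]mulrCA ler_pM2l.
case: ifPn => [/andP[/eqP-> p0] _|_ _]; last by rewrite leNye.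
case: hp => [|/andP[_ p1]]; first by move/(lt_trans p0); rewrite ltxx.
rewrite lee_fin sub0r mulrN divfK ?gt_eqF//.
rewrite -{2}[a `^ p]mul1r -mulrBl mulr_ge0 ?ltW// subr_gt0.
by rewrite invf_gt1.
Qed.

Lemma power_utility_le (x y : R) : x <= y ->
  (power_utility p x <= power_utility p y)%E.
Proof.
move=> xy; have [y0|y0] := ltP 0 y.
  apply: le_trans (power_utility_tangent x y0) _.
  rewrite {1}/power_utility y0 lee_fin gerDl mulr_ge0_le0 ?powR_ge0//.
  by rewrite subr_le0.
have := y0; rewrite le_eqVlt => /predU1P[y00|yn].
  rewrite /power_utility; have := xy; rewrite y00 le_eqVlt => /predU1P[->//|xn].
  by rewrite !ltNge !(ltW xn)/= (lt_eqF xn) leNye.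
rewrite /power_utility !ltNge (le_trans xy y0) /=.
by rewrite (lt_eqF (le_lt_trans xy yn)) leNye.
Qed.

Lemma measurable_power_utility : measurable_fun [set: R] (fun x => power_utility p x).
Proof.
rewrite /power_utility.
apply: measurable_fun_ifT => //=.
- by apply: measurable_fun_ltr => //; exact: measurable_id.
- by apply/measurable_EFinP; apply: measurable_funM.
- case: (0 < p) => /=; last by under eq_fun do rewrite andbF; exact: measurable_cst.
  under eq_fun do rewrite andbT.
  apply: measurable_fun_ifT => //=; apply: (measurable_fun_bool true).
  rewrite setTI (_ : _ @^-1` _ = [set 0]); first exact: measurable_set1.
  by apply/seteqP; split => [x /= /eqP|x /= ->]//; rewrite eqxx.
Qed.

End PowerUtility.

(** * The Euclidean inner product *)

Section Dot.
Variables (R : realType) (n : nat).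
Implicit Types (x y z u pi : 'cV[R]_n) (t : R).

Lemma dotC x y : dot x y = dot y x.
Proof. by apply: eq_bigr => i _; rewrite mulrC. Qed.

Lemma dotDl x y z : dot (x + y) z = dot x z + dot y z.
Proof. by rewrite -big_split /=; apply: eq_bigr => i _; rewrite mxE mulrDl. Qed.

Lemma dotZl t x z : dot (t *: x) z = t * dot x z.
Proof. by rewrite [RHS]mulr_sumr; apply: eq_bigr => i _; rewrite mxE mulrA. Qed.

Lemma dotDr x y z : dot z (x + y) = dot z x + dot z y.
Proof. by rewrite dotC dotDl !(dotC z). Qed.

Lemma dotZr t x z : dot z (t *: x) = t * dot z x.
Proof. by rewrite dotC dotZl (dotC z). Qed.

Lemma dot0l z : dot 0 z = 0.
Proof. by rewrite -(scale0r 0) dotZl mul0r. Qed.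

Lemma dot0r z : dot z 0 = 0.
Proof. by rewrite dotC dot0l. Qed.

Lemma dotNl x z : dot (- x) z = - dot x z.
Proof. by rewrite -scaleN1r dotZl mulN1r. Qed.

Lemma dotNr x z : dot z (- x) = - dot z x.
Proof. by rewrite dotC dotNl (dotC z). Qed.

Lemma dot_trmx (c : 'M[R]_n) x y : dot x (c *m y) = dot (c^T *m x) y.
Proof.
rewrite /dot; under eq_bigr do rewrite mxE mulr_sumr.
rewrite exchange_big /=; apply: eq_bigr => j _.
rewrite mxE mulr_suml; apply: eq_bigr => i _.
by rewrite mxE mulrCA mulrA.
Qed.

Lemma dot_ge0 x : 0 <= dot x x.
Proof. by apply: sumr_ge0 => i _; rewrite -expr2 sqr_ge0. Qed.

Lemma dot_eq0 x : (dot x x == 0) = (x == 0).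
Proof.
apply/idP/eqP => [|->]; last by rewrite dot0l.
rewrite /dot psumr_eq0 => [/allP h|i _]; last by rewrite -expr2 sqr_ge0.
apply/colP => i; rewrite mxE.
by have := h i (mem_index_enum _); rewrite mulf_eq0 orbb => /eqP.
Qed.

Lemma enorm_ge0 u : 0 <= enorm u. Proof. exact: sqrtr_ge0. Qed.

Lemma le_coord_enorm u i : `|u i ord0| <= enorm u.
Proof.
rewrite -sqrtr_sqr ler_wsqrtr// /dot (bigD1 i)//= expr2 lerDl.
by apply: sumr_ge0 => j _; rewrite -expr2 sqr_ge0.
Qed.

(** A coordinatewise estimate, whence the 1-norm of [pi]; any constant that is
    independent of [u] serves to dominate the large jumps. *)
Lemma dot_le_enorm pi u : dot pi u <= (\sum_i `|pi i ord0|) * enorm u.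
Proof.
rewrite mulr_suml; apply: ler_sum => i _.
by rewrite (le_trans (ler_norm _))// normrM ler_wpM2l// le_coord_enorm.
Qed.

Lemma dot_trunc pi u : dot pi (trunc u) = if enorm u <= 1 then dot pi u else 0.
Proof. by rewrite /trunc; case: ifP => // _; rewrite dot0r. Qed.

(** Null vectors of a nonnegative quadratic form lie in its kernel: otherwise
    moving from [x] against [c *m x] would make the form negative. *)
Lemma sym_nonneg_ker (c : 'M[R]_n) x :
  sym_nonneg c -> dot x (c *m x) <= 0 -> c *m x = 0.
Proof.
move=> [cT c0] qx.
set z := c *m x; set N := dot z z; set Q := dot z (c *m z).
have Q0 : 0 <= Q := c0 z.
have N0 : 0 <= N := dot_ge0 z.
have key e : 0 < e -> 2 * N <= e * Q.
  move=> e0; have := c0 (x - e *: z).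
  rewrite mulmxBr -scalemxAr -/z.
  rewrite !(dotDl, dotDr, dotNl, dotNr, dotZl, dotZr).
  have -> : dot x (c *m z) = N by rewrite dot_trmx cT.
  rewrite -/N -/Q => h.
  have /= : 0 <= e * (e * Q - 2 * N) by lra.
  by rewrite pmulr_rge0// subr_ge0.
apply/eqP; rewrite -dot_eq0 -/z -/N eq_le N0 andbT leNgt; apply/negP => Npos.
have /key : 0 < N / (Q + 1) by rewrite divr_gt0// ltr_wpDl.
apply/negP; rewrite -ltNge -mulrA [_ * Q]mulrC.
have : Q / (Q + 1) < 1 by rewrite ltr_pdivrMr ?mul1r ?ltrDl// ltr_wpDl.
move=> h; rewrite (@lt_le_trans _ _ (N * 1))//; first by rewrite ltr_pM2l.
by lra.
Qed.

End Dot.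

(** * Borel measurability on column vectors *)

Section Measurability.
Variables (R : realType) (n : nat).
Implicit Types pi : 'cV[R]_n.

Lemma measurable_coord i :
  measurable_fun [set: borelRn R n] (fun u : borelRn R n => u i ord0).
Proof.
apply: (measurability _ (RGenOpens.measurableE R)) => _ [_ [a [b ->] <-]].
rewrite setTI; apply: sub_sigma_algebra.
by apply: open_comp => [x _|]; [exact: coord_continuous|exact: interval_open].
Qed.

Lemma measurable_dot pi :
  measurable_fun [set: borelRn R n] (fun u : borelRn R n => dot pi u).
Proof.
apply: measurable_sum => i; apply: measurable_funM => //.
exact: measurable_coord.
Qed.

Lemma measurable_enorm :
  measurable_fun [set: borelRn R n] (fun u : borelRn R n => enorm u).
Proof.
under eq_fun do rewrite /enorm -powR12_sqrt ?dot_ge0//.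
apply: (measurableT_comp (measurable_powR _)).
by apply: measurable_sum => i; apply: measurable_funM => //; exact: measurable_coord.
Qed.

Lemma measurable_dot_trunc pi :
  measurable_fun [set: borelRn R n] (fun u : borelRn R n => dot pi (trunc u)).
Proof.
under eq_fun do rewrite dot_trunc.
apply: measurable_fun_ifT => //; last exact: measurable_dot.
by apply: measurable_fun_ler => //; exact: measurable_enorm.
Qed.

Lemma halfspace_negE pi :
  halfspace_neg pi = [set u : borelRn R n | dot pi u < 0].
Proof.
apply/seteqP; split => u /= => [[]//|pu]; split => //.
by apply: contraTneq pu => ->; rewrite dot0r ltxx.
Qed.

Lemma halfspace_posE pi : halfspace_pos pi = halfspace_neg (- pi).
Proof.
by apply/seteqP; split => u; rewrite /halfspace_neg /= => -[u0];
  rewrite dotNl oppr_lt0.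
Qed.

Lemma off_hyperplaneE pi :
  off_hyperplane pi = halfspace_neg pi `|` halfspace_pos pi.
Proof.
apply/seteqP; split => u /=.
  by move=> [u0]; rewrite neq_lt => /orP[]; [left|right].
by move=> [[u0 pu]|[u0 pu]]; split => //; rewrite neq_lt pu ?orbT.
Qed.

Lemma measurable_dot_lt pi (a : R) : measurable [set u : borelRn R n | dot pi u < a].
Proof.
have := measurable_fun_ltr (measurable_dot pi) (measurable_cst a).
move=> /(_ measurableT [set true]); rewrite setTI => h.
suff <- : (fun u : borelRn R n => dot pi u < a) @^-1` [set true] =
          [set u : borelRn R n | dot pi u < a] by exact: h.
by apply/seteqP; split.
Qed.

Lemma measurable_halfspace_neg pi : measurable (halfspace_neg pi).
Proof. by rewrite halfspace_negE; exact: measurable_dot_lt. Qed.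

End Measurability.

(** * Integrals and limits of extended real functions *)

Section IntegralComparison.
Context {d} {T : measurableType d} {R : realType}.
Variable mu : {measure set T -> \bar R}.
Local Open Scope ereal_scope.

(** The comparison holds separately for the positive and the negative parts,
    and extended subtraction is monotone, so infinite integrals are covered. *)
Lemma le_integral_ae (f g : T -> \bar R) :
  measurable_fun setT f -> measurable_fun setT g ->
  {ae mu, forall x, f x <= g x} ->
  \int[mu]_x f x <= \int[mu]_x g x.
Proof.
move=> mf mg fg; rewrite integralE [leRHS]integralE leeB//.
- apply: ae_ge0_le_integral => //; [exact: measurable_funepos..|].
  apply: filterS fg => x fgx _; rewrite !funeposE ge_max le_max fgx/=.
  by rewrite le_max lexx orbT.
- apply: ae_ge0_le_integral => //; [exact: measurable_funeneg..|].
  apply: filterS fg => x fgx _; rewrite !funenegE ge_max le_max leeN2 fgx/=.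
  by rewrite le_max lexx orbT.
Qed.

Lemma integrable_dominated_above (f : T -> \bar R) (h : T -> R) :
  measurable_fun setT f -> mu.-integrable setT (EFin \o h) ->
  (forall x, f x <= (h x)%:E) -> -oo < \int[mu]_x f x ->
  mu.-integrable setT f.
Proof.
move=> mf ih fh; rewrite integralE => intf.
have fp : \int[mu]_x f^\+ x < +oo.
  apply: le_lt_trans (integrable_lty measurableT
    (integrable_funepos measurableT ih)).
  apply: ge0_le_integral => //; first exact: measurable_funepos.
    by apply: measurable_funepos; exact: measurable_int ih.
  move=> x _; rewrite !funeposE ge_max !le_max /= fh/=.
  by rewrite lexx orbT.
have fn : \int[mu]_x f^\- x < +oo.
  rewrite ltey; apply: contraTneq intf => ->; rewrite addeNy ltxx//.
apply/integrableP; split=> //.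
rewrite -[fun x => _]/(abse \o f) fune_abse ge0_integralD//;
  [exact: lte_add_pinfty|exact: measurable_funepos|exact: measurable_funeneg].
Qed.

End IntegralComparison.

Section LimInf.
Variable R : realType.
Local Open Scope ereal_scope.
Implicit Type u : (\bar R)^nat.

Lemma limn_einf_ge u (l : \bar R) (N : nat) :
  (forall m, (N <= m)%N -> l <= u m) -> l <= limn_einf u.
Proof.
move=> h; rewrite limn_einf_lim; apply: lime_ge; first exact: is_cvg_einfs.
exists N => // m /= Nm; apply: le_ereal_inf_tmp => _ [k /= mk <-].
exact/h/(leq_trans Nm).
Qed.

Lemma limn_einf_le u (l : \bar R) :
  (forall m, u m <= l) -> limn_einf u <= l.
Proof.
move=> h; rewrite limn_einf_lim; apply: lime_le; first exact: is_cvg_einfs.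
apply: nearW => m; apply: le_trans (h m); apply: ereal_inf_lbound.
by exists m => /=.
Qed.

End LimInf.

(** * The jump integrand *)

Section JumpGain.
Variables (R : realType) (n : nat) (p : R).
Hypothesis hp : p < 0 \/ 0 < p < 1.
Variable F : {measure set (borelRn R n) -> \bar R}.
Hypothesis hF : levy_measure F.
Hypothesis hAF : p_integrable_tails p F.
Implicit Types (pi x u : 'cV[R]_n) (t : R).

Definition jump_gain pi u : \bar R :=
  (power_utility p (1 + dot pi u)%R - (p^-1)%:E - (dot pi (trunc u))%:E)%E.

(** An F-integrable function with [jump_gain (t *: pi) <= t * tail_bound pi]
    for all [t >= 1].  Small jumps contribute 0 by concavity of the utility.  On
    large jumps, for p < 0 the utility is nonpositive; for 0 < p < 1 one has
    1 + t pi.u <= t (1 + |pi|_1) |u| and t^p <= t. *)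
Definition tail_bound pi u : R :=
  if enorm u <= 1 then 0
  else if p < 0 then - p^-1
  else p^-1 * (1 + \sum_i `|pi i ord0|) `^ p * enorm u `^ p.

Lemma jump_gain_le pi u t : 1 <= t ->
  (jump_gain (t *: pi) u <= (t * tail_bound pi u)%:E)%E.
Proof.
move=> t1; have t0 : 0 < t by rewrite (lt_le_trans ltr01).
rewrite /jump_gain /tail_bound dot_trunc !dotZl; set x := dot pi u.
case: ifPn => [u1|]; first rewrite mulr0.
  rewrite leeBlDr// leeBlDr// -!EFinD.
  have := power_utility_tangent hp (1 + t * x) ltr01.
  by rewrite !powR1 mulr1 mul1r => /le_trans; apply; rewrite lee_fin; lra.
rewrite -ltNge => u1; rewrite sube0 leeBlDr// -!EFinD.
have u0 : 0 < enorm u by rewrite (lt_trans ltr01).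
case: hp => [p0|/andP[p0 p1]].
  rewrite p0 (@le_trans _ _ 0%E)//.
    rewrite /power_utility; case: ifP => _.
      by rewrite lee_fin mulr_le0_ge0 ?powR_ge0// invr_le0 ltW.
    by case: ifP => _.
  have ip : p^-1 < 0 by rewrite invr_lt0.
  by rewrite lee_fin; nra.
rewrite ltNge (ltW p0)/=; set S := \sum_i _.
have S0 : 0 <= S by exact: sumr_ge0.
have ip : 0 < p^-1 by rewrite invr_gt0.
have : (power_utility p (1 + t * x) <= power_utility p (t * ((1 + S) * enorm u)))%E.
  apply: power_utility_le => //.
  have := dot_le_enorm pi u; rewrite -/S -/x => xS.
  have : t * x <= t * (S * enorm u) by rewrite ler_pM2l.
  have : 1 <= t * enorm u by rewrite -[1]mulr1 ler_pM// ltW.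
  by lra.
move=> /le_trans; apply.
rewrite /power_utility !mulr_gt0 ?ltr_wpDr// lee_fin.
have S1 : 0 <= 1 + S by rewrite addr_ge0.
rewrite !powRM ?mulr_ge0 ?enorm_ge0//; last exact: ltW.
have tp : t `^ p <= t by rewrite ler1_powR// ltW.
apply: ler_wpDr; first exact: ltW.
have q0 : 0 <= p^-1 * ((1 + S) `^ p * enorm u `^ p).
  by rewrite !mulr_ge0 ?powR_ge0// ltW.
by rewrite mulrCA -[p^-1 * _ * _]mulrA ler_wpM2r.
Qed.

Lemma tail_bound_ge0 pi u : 0 <= tail_bound pi u.
Proof.
rewrite /tail_bound; case: ifP => // _; case: ltP => p0.
  by rewrite oppr_ge0 invr_le0 ltW.
by rewrite !mulr_ge0 ?powR_ge0// invr_ge0.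
Qed.

Lemma measurable_enorm_le1 :
  measurable_fun [set: borelRn R n] (fun u : borelRn R n => enorm u <= 1).
Proof. by apply: measurable_fun_ler => //; exact: measurable_enorm. Qed.

Lemma measurable_tail_bound pi :
  measurable_fun [set: borelRn R n] (fun u : borelRn R n => tail_bound pi u).
Proof.
apply: measurable_fun_ifT => //; first exact: measurable_enorm_le1.
case: ltP => // _.
apply: measurable_funM => //.
exact: (measurableT_comp (measurable_powR _) (@measurable_enorm R n)).
Qed.

Lemma integrable_tail_bound pi :
  F.-integrable [set: borelRn R n] (EFin \o tail_bound pi).
Proof.
have mb := measurable_tail_bound pi.
case: hp => [p0|/[dup] p01 /andP[p0 p1]].
- have [_ hF2] := hF.
  have mm : measurable_fun [set: borelRn R n]
      (fun u : borelRn R n => (Num.min (enorm u ^+ 2) 1)%:E).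
    apply/measurable_EFinP; apply: measurable_minr => //.
    by apply: measurable_funX; exact: measurable_enorm.
  have min0 u : 0 <= Num.min (enorm u ^+ 2) 1.
    by rewrite le_min sqr_ge0 ler01.
  have im : F.-integrable [set: borelRn R n]
      (fun u : borelRn R n => (Num.min (enorm u ^+ 2) 1)%:E).
    apply/integrableP; split => //.
    by under eq_integral do rewrite gee0_abs ?lee_fin//.
  apply: le_integrable (integrableZl measurableT (- p^-1) im) => //.
    exact/measurable_EFinP.
  move=> u _ /=; rewrite lee_fin ger0_norm ?tail_bound_ge0// normrM.
  rewrite (ger0_norm (min0 _)) /tail_bound p0.
  case: ifPn => [_|]; first by rewrite mulr_ge0.
  rewrite -ltNge => u1; rewrite (_ : Num.min _ _ = 1) ?mulr1 ?ler_norm//.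
  by apply/min_idPr; rewrite expr_ge1 ?enorm_ge0// ltW.
- have := hAF p01; set D := [set u | _] => iD.
  have mD : measurable D.
    have := measurable_fun_ltr (measurable_cst (1 : R)) (@measurable_enorm R n).
    move=> /(_ measurableT [set true]); rewrite setTI => h.
    suff <- : (fun u : borelRn R n => 1 < enorm u) @^-1` [set true] = D by exact: h.
    by apply/seteqP; split.
  have mf : measurable_fun [set: borelRn R n]
      (fun u : borelRn R n => (enorm u `^ p)%:E).
    apply/measurable_EFinP.
    exact: (measurableT_comp (measurable_powR _) (@measurable_enorm R n)).
  have int : F.-integrable D (fun u : borelRn R n => (enorm u `^ p)%:E).
    apply/integrableP; split; first exact: measurable_funS mf.
    by under eq_integral do rewrite gee0_abs ?lee_fin ?powR_ge0//.
  have := (integrable_mkcond _ mD).1 int.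
  move=> /(integrableZl measurableT (p^-1 * (1 + \sum_i `|pi i ord0|) `^ p)).
  apply: eq_integrable => // u _ /=; rewrite /tail_bound patchE.
  rewrite ltNge (ltW p0)/=; case: ifPn => [|].
    by rewrite inE /D /= ltNge => /negbTE ->; rewrite EFinM.
  by rewrite notin_setE /D /= => /negP; rewrite -leNgt => ->; rewrite mule0.
Qed.

Lemma measurable_jump_gain pi :
  measurable_fun [set: borelRn R n] (fun u : borelRn R n => jump_gain pi u).
Proof.
apply: emeasurable_funB; first apply: emeasurable_funB => //.
  apply: (measurableT_comp (measurable_power_utility p)).
  by apply: measurable_funD => //; exact: measurable_dot.
by apply/measurable_EFinP; exact: measurable_dot_trunc.
Qed.

(** The gain from jumps is at most linear along rays, so it cannot compensate
    a quadratic diffusion term. *)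
Lemma integral_jump_gain_le pi t : 1 <= t ->
  (\int[F]_u jump_gain (t *: pi) u <=
   t%:E * \int[F]_u (tail_bound pi u)%:E)%E.
Proof.
move=> t1; rewrite -integralZl//; last exact: integrable_tail_bound.
apply: le_integral_ae; first exact: measurable_jump_gain.
  by apply: measurable_funeM; apply/measurable_EFinP; exact: measurable_tail_bound.
by apply: aeW => u; rewrite -EFinM; exact: jump_gain_le.
Qed.

Lemma integrable_jump_gain pi :
  (-oo < \int[F]_u jump_gain pi u)%E ->
  F.-integrable [set: borelRn R n] (jump_gain pi).
Proof.
apply: (@integrable_dominated_above _ (borelRn R n) R F (jump_gain pi)
  (tail_bound pi)).
- exact: measurable_jump_gain.
- exact: integrable_tail_bound.
- by move=> u; have := jump_gain_le pi u (lexx 1); rewrite scale1r mul1r.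
Qed.

End JumpGain.

(** * Sublinear growth of the utility *)

Section PowerGrowth.
Variables (R : realType) (p : R).
Hypothesis hp : p < 0 \/ 0 < p < 1.

(** The slope a^(p-1) of the tangent at [a] vanishes as [a] grows, because
    p < 1. *)
Lemma power_gain_sublinear (x e : R) : 0 <= x -> 0 < e ->
  exists N : nat, forall t : R, N%:R <= t ->
    (power_utility p (1 + t * x) <= (p^-1 + t * e)%:E)%E.
Proof.
move=> x0 e0; have x1 : 0 < x + 1 by rewrite ltr_wpDl.
pose e' := e / 2 / (x + 1).
have e'0 : 0 < e' by rewrite !divr_gt0.
have p1 : p - 1 != 0.
  by rewrite subr_eq0; case: hp => [|/andP[_]] h; rewrite lt_eqF// (lt_trans h).
(* The tangent point at which the slope is exactly [e']. *)
pose a := e' `^ (p - 1)^-1.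
have a0 : 0 < a by rewrite powR_gt0.
have ae' : a `^ (p - 1) = e' by rewrite -powRrM mulVf// powRr1// ltW.
pose K := p^-1 * a `^ p + e' * (1 - a) - p^-1.
have [N KN] : exists N : nat, K / (e / 2) <= N%:R.
  exists (Num.truncn `|K / (e / 2)|).+1.
  by rewrite (le_trans (ler_norm _))// ltW// truncnS_gt.
exists N => t Nt.
apply: le_trans (power_utility_tangent hp (1 + t * x) a0) _.
rewrite ae' lee_fin.
have t0 : 0 <= t by apply: le_trans Nt; rewrite ler0n.
have : K <= t * (e / 2).
  by rewrite -ler_pdivrMr ?divr_gt0//; apply: le_trans Nt.
have ex : e' * x <= e / 2.
  rewrite /e' -mulrA ler_piMr//; first by rewrite divr_ge0// ltW.
  by rewrite mulrC ler_pdivrMr// mul1r lerDl.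
have : t * (e' * x) <= t * (e / 2) by rewrite ler_wpM2l.
by rewrite /K; lra.
Qed.

End PowerGrowth.

(** * The function psi along a ray *)

Section PsiRay.
Variables (R : realType) (n : nat) (p : R).
Variables (b : 'cV[R]_n) (c : 'M[R]_n).
Variable F : {measure set (borelRn R n) -> \bar R}.
Hypothesis hp : p < 0 \/ 0 < p < 1.
Hypothesis hF : levy_measure F.
Hypothesis hAF : p_integrable_tails p F.
Implicit Types (pi x u : 'cV[R]_n) (t : R).
Local Notation psi := (psi p b c F).

Lemma budget_setE pi :
  budget_set F pi <-> F [set u : borelRn R n | dot pi u < -1] = 0%E.
Proof.
rewrite /budget_set /= (_ : [set u | _] = [set u : borelRn R n | dot pi u < -1])//.
apply/seteqP; split => u /=.
  by move=> [_]; rewrite -ltrBrDr sub0r.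
move=> pu; rewrite -ltrBrDr sub0r; split => //; apply: contraTneq pu => ->.
by rewrite dot0r ltr0N1.
Qed.

Lemma psiE pi : budget_set F pi ->
  psi pi = ((- dot pi b - (p - 1) / 2 * dot pi (c *m pi))%:E
            - \int[F]_u jump_gain p pi u)%E.
Proof. by move=> bpi; rewrite /Defs.psi mem_set. Qed.

Lemma psi_lty pi : (psi pi < +oo)%E -> budget_set F pi.
Proof.
by rewrite /Defs.psi; case: ifPn => [/set_mem//|]; rewrite ltxx.
Qed.

Lemma psi0 : psi 0 = 0%E.
Proof.
have -> : psi 0 = ((- dot 0 b - (p - 1) / 2 * dot 0 (c *m 0))%:E
            - \int[F]_u jump_gain p 0 u)%E.
  apply: psiE; apply/budget_setE; rewrite (_ : [set u | _] = set0) ?measure0//.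
  by apply/seteqP; split => u //=; rewrite dot0l ltr0N1.
rewrite !dot0l mulr0 subr0 oppr0 integral0_eq ?sube0// => u _.
rewrite /jump_gain !dot0l addr0 /power_utility ltr01 powR1 mulr1.
by rewrite -!EFinB subrr subr0.
Qed.

(** The sets where m (pi.u) < -1 increase to the half-space of [pi] as m
    grows; if all were null, so would be the half-space. *)
Lemma exits_budget_set pi : (0 < F (halfspace_neg pi))%E ->
  exists2 t : R, 0 <= t & ~ budget_set F (t *: pi).
Proof.
move=> F0; apply: contrapT => h.
have {}h (m : nat) : F [set u : borelRn R n | dot (m.+1%:R *: pi) u < -1] = 0%E.
  apply/budget_setE; apply: contrapT => nb; apply: h; by exists m.+1%:R.
move: F0; rewrite halfspace_negE.
suff -> : F [set u : borelRn R n | dot pi u < 0] = 0%E by rewrite ltxx.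
apply/negligibleP; first exact: measurable_dot_lt.
apply: (@negligibleS _ _ _ F (\bigcup_(m : nat)
    [set u : borelRn R n | dot (m.+1%:R *: pi) u < -1])).
  move=> u /= pu; exists (Num.truncn (- (dot pi u))^-1) => //=.
  have pu' : 0 < - dot pi u by rewrite oppr_gt0.
  rewrite dotZl -ltrN2 opprK -mulrN -ltr_pdivrMr// mul1r.
  exact: truncnS_gt.
apply: negligible_bigcup => m; apply/negligibleP.
  exact: measurable_dot_lt.
exact: h.
Qed.

(** Dividing psi (t pi) <= t mu by t leaves a bound on (1-p)/2 t pi.(c pi)
    that does not depend on t, once the jump term is controlled linearly. *)
Lemma quad_form_le0_of_linear_ray pi (mu : R) :
  (forall t, 0 <= t -> (psi (t *: pi) <= (t * mu)%:E)%E) ->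
  dot pi (c *m pi) <= 0.
Proof.
move=> h; set Q := dot pi _; rewrite leNgt; apply/negP => Q0.
have iH := integrable_tail_bound hp hF hAF pi.
set M : R := fine (\int[F]_u (tail_bound p pi u)%:E).
have ME : (\int[F]_u (tail_bound p pi u)%:E = M%:E)%E.
  by rewrite /M fineK//; exact: integrable_fin_num.
have k0 : 0 < (1 - p) / 2.
  by case: hp => [|/andP[]]; lra.
set k := (1 - p) / 2 in k0.
have key t : 1 <= t -> k * Q * t <= mu + dot pi b + M.
  move=> t1; have t0 : 0 < t by rewrite (lt_le_trans ltr01).
  have ht := h t (ltW t0).
  have := psi_lty (le_lt_trans ht (ltry _)) => /psiE psit.
  move: ht; rewrite psit !dotZl -scalemxAr dotZr -/Q => ht.
  have := integral_jump_gain_le hp hF hAF pi t1; rewrite ME -EFinM => gM.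
  have : ((- (t * dot pi b) - (p - 1) / 2 * (t * (t * Q)))%:E - (t * M)%:E <=
      (t * mu)%:E)%E by apply: le_trans ht; rewrite leeB.
  rewrite -EFinB lee_fin => {}ht.
  by rewrite -(ler_pM2l t0) /k; lra.
have kQ : 0 < k * Q by rewrite mulr_gt0.
set K := mu + dot pi b + M in key.
(* At this [t] the left-hand side exceeds [`|K|]. *)
have := key (1 + `|K| / (k * Q)); rewrite lerDl divr_ge0 ?(ltW kQ)// => /(_ isT).
rewrite mulrDr mulr1 [_ * (_ / _)]mulrC divfK ?gt_eqF//.
by have := ler_norm K; lra.
Qed.

(** Fatou's lemma for tail_bound - g_(t pi) / t along integers t = m + 1.
    These functions are nonnegative by [jump_gain_le], their integrals are
    bounded through psi (t pi) <= t mu, and their limit is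
    tail_bound + pi.h(u) where pi.u >= 0. *)
Lemma drift_diff_le_ray_slope pi (mu : R) :
  F (halfspace_neg pi) = 0%E -> c *m pi = 0 ->
  (forall t, 0 <= t -> (psi (t *: pi) <= (t * mu)%:E)%E) ->
  (drift_diff b F pi <= mu%:E)%E.
Proof.
move=> F0 cpi h; rewrite /drift_diff leeBlDr// -EFinD.
have iH := integrable_tail_bound hp hF hAF pi.
have mH := @measurable_tail_bound R n p pi.
set M : R := fine (\int[F]_u (tail_bound p pi u)%:E).
have ME : (\int[F]_u (tail_bound p pi u)%:E = M%:E)%E.
  by rewrite /M fineK//; exact: integrable_fin_num.
pose s (m : nat) : R := m.+1%:R.
have s1 m : 1 <= s m by rewrite /s ler1n.
have s0 m : 0 < s m by rewrite (lt_le_trans ltr01).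
pose f (m : nat) (u : borelRn R n) : \bar R :=
  ((tail_bound p pi u)%:E - (s m)^-1%:E * jump_gain p (s m *: pi) u)%E.
have mf m : measurable_fun [set: borelRn R n] (f m).
  apply: emeasurable_funB; first exact/measurable_EFinP.
  by apply: measurable_funeM; exact: measurable_jump_gain.
have f0 m u : (0 <= f m u)%E.
  have := jump_gain_le hp pi u (s1 m); rewrite /f.
  case: (jump_gain _ _ _) => [r| |] //.
  - by rewrite -EFinM -EFinB !lee_fin subr_ge0 ler_pdivrMl.
  - by rewrite gt0_muleNy ?lte_fin ?invr_gt0//= leey.
have intf m : (\int[F]_u f m u <= (M + (mu + dot pi b))%:E)%E.
  have ht := h (s m) (ltW (s0 m)).
  have := psi_lty (le_lt_trans ht (ltry _)) => /psiE psit.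
  move: ht; rewrite psit -scalemxAr cpi scaler0 dot0r mulr0 subr0 dotZl => ht.
  have ig : F.-integrable [set: borelRn R n] (jump_gain p (s m *: pi)).
    apply: integrable_jump_gain => //; rewrite ltNye.
    by apply: contraTneq ht => ->.
  rewrite integralB//; last exact: integrableZl.
  rewrite ME integralZl// EFinD leeD2l//.
  move: ht; rewrite -(fineK (integrable_fin_num measurableT ig)).
  set I := fine _; rewrite -EFinB -EFinM -EFinN !lee_fin => ht.
  rewrite -(ler_pM2l (s0 m)) mulrN mulrA divff ?gt_eqF// mul1r.
  by lra.
pose tau (u : borelRn R n) : \bar R := (dot pi (trunc u))%:E.
have mtau : measurable_fun [set: borelRn R n] tau.
  by apply/measurable_EFinP; exact: measurable_dot_trunc.
have mliminf : measurable_fun [set: borelRn R n] (fun u => limn_einf (f ^~ u)).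
  rewrite /limn_einf; apply: measurableT_comp => //.
  by apply: measurable_fun_limn_esup => m; exact: measurableT_comp.
(* Passing to the positive part makes additivity with [tail_bound] available
   without knowing yet that [tau] is integrable. *)
apply: (@le_trans _ _ (\int[F]_u tau^\+ u)%E).
  rewrite [leLHS]integralE -[leRHS]sube0 leeB//.
  exact: integral_ge0.
rewrite -(@leeD2lE _ M%:E)// -ME -ge0_integralD//; last 3 first.
- by move=> u _; rewrite lee_fin tail_bound_ge0.
- exact/measurable_EFinP.
- exact: measurable_funepos.
apply: (@le_trans _ _ (\int[F]_u limn_einf (f ^~ u))%E); last first.
  apply: le_trans (fatou _ _ _ _) _ => //.
  by apply: limn_einf_le => m; rewrite ME -EFinD.
apply: le_integral_ae => //.
  by apply: emeasurable_funD; [exact/measurable_EFinP|exact: measurable_funepos].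
exists (halfspace_neg pi); split => //.
  exact: measurable_halfspace_neg.
rewrite halfspace_negE => u /=; apply: contra_notP => /negP; rewrite -leNgt => x0.
have tau0 : 0 <= dot pi (trunc u) by rewrite dot_trunc; case: ifP.
have -> : (tau^\+ u = tau u)%E by rewrite funeposE; apply/max_idPl; rewrite lee_fin.
apply/lee_addgt0Pr => e e0; rewrite -leeBlDr//.
have [N hN] := power_gain_sublinear hp x0 e0.
apply: (@limn_einf_ge _ _ _ N) => m Nm.
have : N%:R <= s m by rewrite /s ler_nat (leq_trans Nm).
move/hN; rewrite /f /jump_gain /tau !dotZl /power_utility.
have -> : 0 < 1 + s m * dot pi u by rewrite ltr_wpDr// mulr_ge0// ltW.
set U := p^-1 * _; set T := dot pi (trunc u); set H := tail_bound p pi u.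
rewrite lee_fin => hU.
change ((H + T - e)%:E <= (H - (s m)^-1 * (U - p^-1 - s m * T))%:E)%E.
have : (s m)^-1 * (U - p^-1 - s m * T) <= e - T by rewrite ler_pdivrMl//; lra.
rewrite lee_fin; set X := _^-1 * _ => hX; lra.
Qed.

End PsiRay.

(** * The drift term *)

Section Drift.
Variables (R : realType) (n : nat) (b : 'cV[R]_n).
Variable F : {measure set (borelRn R n) -> \bar R}.
Implicit Types pi : 'cV[R]_n.

Lemma ae_dot_ge0 pi : F (halfspace_neg pi) = 0%E ->
  {ae F, forall u : borelRn R n, 0 <= dot pi u}.
Proof.
move=> F0; exists (halfspace_neg pi); split => //.
  exact: measurable_halfspace_neg.
by rewrite halfspace_negE => u /= /negP; rewrite -ltNge.
Qed.

Lemma ae_dot_trunc_ge0 pi : F (halfspace_neg pi) = 0%E ->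
  {ae F, forall u : borelRn R n, 0 <= dot pi (trunc u)}.
Proof.
by move=> /ae_dot_ge0; apply: filterS => u u0; rewrite dot_trunc; case: ifP.
Qed.

Let measurable_tau pi :
  measurable_fun [set: borelRn R n] (fun u : borelRn R n => (dot pi (trunc u))%:E).
Proof. by apply/measurable_EFinP; exact: measurable_dot_trunc. Qed.

Lemma integral_dot_trunc_ge0 pi : F (halfspace_neg pi) = 0%E ->
  (0 <= \int[F]_u (dot pi (trunc u))%:E)%E.
Proof.
move=> F0; rewrite -(integral0 F setT); apply: le_integral_ae => //.
by apply: filterS (ae_dot_trunc_ge0 F0) => u; rewrite lee_fin.
Qed.

(** The sign condition excludes that both parts of the integral are infinite,
    in which case the extended difference would not be odd. *)
Lemma drift_diffN pi : F (halfspace_neg pi) = 0%E ->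
  drift_diff b F (- pi) = (- drift_diff b F pi)%E.
Proof.
move=> F0; rewrite /drift_diff dotNl EFinN oppeK fin_num_oppeB//; congr +%E.
pose f (u : borelRn R n) : \bar R := (dot pi (trunc u))%:E.
under eq_integral do rewrite dotNl EFinN.
rewrite (@integralN _ _ _ F setT f)//.
suff -> : (\int[F]_u f^\- u = 0)%E by rewrite oppe0 fin_num_adde_defl.
apply/eqP; rewrite eq_le integral_ge0// andbT.
rewrite -(integral0 F setT); apply: le_integral_ae => //.
  by apply: measurable_funeneg; exact: measurable_tau.
apply: filterS (ae_dot_trunc_ge0 F0) => u u0.
by rewrite funenegE ge_max lexx andbT leeNl oppe0 lee_fin.
Qed.

Lemma drift_diff_off_hyperplane pi : F (off_hyperplane pi) = 0%E ->
  [/\ F (halfspace_neg pi) = 0%E, F (halfspace_neg (- pi)) = 0%E &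
      drift_diff b F pi = (- dot pi b)%:E].
Proof.
rewrite off_hyperplaneE halfspace_posE => F0.
have mn := @measurable_halfspace_neg R n.
have Fn : F (halfspace_neg pi) = 0%E.
  by apply: subset_measure0 F0 => //; exact: measurableU.
have Fp : F (halfspace_neg (- pi)) = 0%E.
  by apply: subset_measure0 F0 => //; exact: measurableU.
split=> //; rewrite /drift_diff EFinN.
suff -> : (\int[F]_u (dot pi (trunc u))%:E = 0)%E by rewrite add0e.
apply/eqP; rewrite eq_le integral_dot_trunc_ge0// andbT.
rewrite -(integral0 F setT); apply: le_integral_ae => //.
by apply: filterS (ae_dot_trunc_ge0 Fp) => u; rewrite dotNl oppr_ge0.
Qed.

End Drift.

(** * The recession function of psi *)

Section RecessionPsi.
Variables (R : realType) (n : nat) (p : R).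
Variables (b : 'cV[R]_n) (c : 'M[R]_n).
Variable F : {measure set (borelRn R n) -> \bar R}.
Hypothesis hp : p < 0 \/ 0 < p < 1.
Hypothesis hc : sym_nonneg c.
Hypothesis hF : levy_measure F.
Hypothesis hAF : p_integrable_tails p F.
Implicit Types (pi x u : 'cV[R]_n) (t : R).
Local Notation psi := (psi p b c F).

Lemma budget_setD pi x t : F (halfspace_neg pi) = 0%E -> 0 <= t ->
  budget_set F x -> budget_set F (x + t *: pi).
Proof.
rewrite halfspace_negE => F0 t0 /budget_setE bx; apply/budget_setE.
apply/negligibleP; first exact: measurable_dot_lt.
apply: (@negligibleS _ _ _ F ([set u : borelRn R n | dot x u < -1] `|`
   [set u : borelRn R n | dot pi u < 0])).
  move=> u /=; rewrite dotDl dotZl => h; have [|xu] := ltP (dot x u) (-1).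
    by left.
  right; rewrite ltNge; apply: contraTN h => pu.
  by rewrite -leNgt -[-1]addr0 lerD// mulr_ge0.
by apply: negligibleU; apply/negligibleP => //; exact: measurable_dot_lt.
Qed.

(** The utility increases along [pi], so the jump integrand at [x + t *: pi]
    is at least the one at [x] minus [t] times [dot pi (trunc u)], and the
    latter is integrable because the drift is finite.  Finiteness of [psi x]
    makes [jump_gain p x] integrable, hence the integral additive. *)
Lemma psi_add_drift pi (mu : R) : F (halfspace_neg pi) = 0%E -> c *m pi = 0 ->
  drift_diff b F pi = mu%:E ->
  forall x t, 0 <= t -> (psi x < +oo)%E ->
    (psi (x + t *: pi) <= psi x + (t * mu)%:E)%E.
Proof.
move=> F0 cpi dmu x t t0 px; have bx := psi_lty px.
have [cT _] := hc.
move: px; rewrite (psiE p b c bx) (psiE p b c (budget_setD F0 t0 bx)) => px.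
rewrite mulmxDr -scalemxAr cpi scaler0 addr0 !dotDl !dotZl.
have -> : dot pi (c *m x) = 0 by rewrite dot_trmx cT cpi dot0l.
rewrite mulr0 addr0.
pose tau (u : borelRn R n) : \bar R := (dot pi (trunc u))%:E.
have mtau : measurable_fun [set: borelRn R n] tau.
  by apply/measurable_EFinP; exact: measurable_dot_trunc.
have Itau : (\int[F]_u tau u = (mu + dot pi b)%:E)%E.
  by rewrite EFinD -dmu /drift_diff subeK.
have itau : F.-integrable [set: borelRn R n] tau.
  apply/integrableP; split => //; apply: le_lt_trans (ltry (mu + dot pi b)).
  rewrite -Itau; apply: le_integral_ae => //; first exact: measurableT_comp.
  apply: filterS (ae_dot_trunc_ge0 F0) => u u0.
  by rewrite gee0_abs// lee_fin.
have ig : F.-integrable [set: borelRn R n] (jump_gain p x).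
  apply: integrable_jump_gain => //; rewrite ltNye.
  by apply: contraTneq px => ->.
have : (\int[F]_u (jump_gain p x u - t%:E * tau u) <=
        \int[F]_u jump_gain p (x + t *: pi) u)%E.
  apply: le_integral_ae; [|exact: measurable_jump_gain|].
    apply: emeasurable_funB; first exact: measurable_jump_gain.
    exact: measurable_funeM.
  apply: filterS (ae_dot_ge0 F0) => u u0; rewrite /jump_gain /tau.
  rewrite dotDl !dotDl !dotZl EFinD EFinM fin_num_oppeD// addeA leeB//.
  rewrite leeB// leeB//; apply: power_utility_le => //.
  by rewrite lerD2l lerDl mulr_ge0.
rewrite integralB//; last exact: integrableZl.
rewrite integralZl// Itau -(fineK (integrable_fin_num measurableT ig)).
set I := fine _; rewrite -EFinM -EFinB => hI.
apply: (@le_trans _ _ ((- (dot x b + t * dot pi b) - (p - 1) / 2 * dot x (c *m x))%:E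
   - (I - t * (mu + dot pi b))%:E)%E); first by rewrite leeB.
by rewrite -!EFinB -EFinD lee_fin; lra.
Qed.

Lemma recession_psi_drift pi : F (halfspace_neg pi) = 0%E -> c *m pi = 0 ->
  recession_fun psi pi = drift_diff b F pi.
Proof.
move=> F0 cpi; apply/eqP; rewrite eq_le; apply/andP; split.
  case dE : (drift_diff b F pi) => [mu| |]; last 2 first.
  - by rewrite leey.
  - move: dE; have := integral_dot_trunc_ge0 F0; rewrite /drift_diff.
    by case: (\int[F]_u _)%E.
  by apply: recession_fun_le; exact: psi_add_drift.
apply: recession_fun_ge; first by rewrite psi0.
by move=> mu; exact: drift_diff_le_ray_slope.
Qed.

Lemma recession_psi_diffusion pi : c *m pi <> 0 ->
  recession_fun psi pi = +oo%E.
Proof.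
move=> cpi; apply/eqP; rewrite -leye_eq.
apply: recession_fun_ge; first by rewrite psi0.
move=> mu h; exfalso; apply: cpi; apply: sym_nonneg_ker => //.
exact: (quad_form_le0_of_linear_ray hp hF hAF h).
Qed.

Lemma recession_psi_jumps pi : (0 < F (halfspace_neg pi))%E ->
  recession_fun psi pi = +oo%E.
Proof.
move=> F0; apply/eqP; rewrite -leye_eq.
apply: recession_fun_ge; first by rewrite psi0.
move=> mu h; exfalso.
have [t t0 nb] := exits_budget_set F0.
by apply: nb; apply: psi_lty; exact: le_lt_trans (h t t0) (ltry _).
Qed.

Lemma recession_psi_le0 pi : (recession_fun psi pi <= 0)%E <->
  [/\ F (halfspace_neg pi) = 0%E, c *m pi = 0 & (drift_diff b F pi <= 0)%E].
Proof.
split=> [h|[F0 cpi]]; last by rewrite recession_psi_drift.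
have F0 : F (halfspace_neg pi) = 0%E.
  apply/eqP; rewrite eq_le measure_ge0 andbT leNgt; apply/negP => F0.
  by move: h; rewrite recession_psi_jumps.
have cpi : c *m pi = 0.
  by apply: contrapT => cpi; move: h; rewrite recession_psi_diffusion.
by split=> //; rewrite -recession_psi_drift.
Qed.

End RecessionPsi.

Unset Implicit Arguments.

Theorem lemma3p6 (R : realType) (n : nat) (p : R)
    (b : 'cV[R]_n) (c : 'M[R]_n) (F : {measure set (borelRn R n) -> \bar R})
    (hp : p < 0 \/ 0 < p < 1)
    (hc : sym_nonneg c)
    (hF : levy_measure F)
    (hAF : p_integrable_tails p F) :
  [/\ forall pi : 'cV[R]_n,
        (F (halfspace_neg pi) = 0%E ->
           (c *m pi = 0 ->
              recession_fun (psi p b c F) pi = drift_diff b F pi) /\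
           (c *m pi <> 0 -> recession_fun (psi p b c F) pi = +oo%E)) /\
        ((0 < F (halfspace_neg pi))%E ->
           recession_fun (psi p b c F) pi = +oo%E),
      forall pi : 'cV[R]_n,
        (F (halfspace_pos pi) = 0%E ->
           (c *m pi = 0 ->
              recession_fun (psi p b c F) (- pi) = (- drift_diff b F pi)%E) /\
           (c *m pi <> 0 -> recession_fun (psi p b c F) (- pi) = +oo%E)) /\
        ((0 < F (halfspace_pos pi))%E ->
           recession_fun (psi p b c F) (- pi) = +oo%E),
      recession_cone (psi p b c F) =
        [set pi | [/\ F (halfspace_neg pi) = 0%E, c *m pi = 0
                    & (drift_diff b F pi <= 0)%E]]
    & constancy_space (psi p b c F) = null_investments b c F].
Proof.
have cone pi := recession_psi_le0 b hp hc hF hAF pi.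
split.
- move=> pi; split=> [F0|]; last exact: recession_psi_jumps.
  split; first exact: recession_psi_drift.
  exact: recession_psi_diffusion.
- move=> pi; rewrite halfspace_posE; split=> [F0|]; last exact: recession_psi_jumps.
  split=> cpi; last first.
    by apply: recession_psi_diffusion => //; rewrite mulmxN => /eqP; rewrite oppr_eq0 => /eqP.
  rewrite recession_psi_drift// ?mulmxN ?cpi ?oppr0//.
  have := drift_diffN b F0; rewrite opprK => ->; by rewrite oppeK.
- by apply/funext => pi; apply/propext; exact: cone.
- apply/funext => pi; apply/propext; split.
  + move=> [/cone[Fn cpi dn] /cone[Fp _ dp]].
    have F0 : F (off_hyperplane pi) = 0%E.
      rewrite off_hyperplaneE halfspace_posE.
      have mn := @measurable_halfspace_neg R n.
      apply/negligibleP; first exact: measurableU.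
      by apply: negligibleU; apply/negligibleP.
    split=> //; have [_ _ dE] := drift_diff_off_hyperplane b F0.
    move: dn dp; rewrite drift_diffN// dE -EFinN !lee_fin opprK.
    by rewrite oppr_le0 => ? ?; apply/eqP; rewrite eq_le; apply/andP.
  + move=> [cpi F0 pb]; have [Fn Fp dE] := drift_diff_off_hyperplane b F0.
    split; apply/cone; split => //.
    * by rewrite dE pb oppr0.
    * by rewrite mulmxN cpi oppr0.
    * by rewrite drift_diffN// dE pb oppr0 oppe0.
Qed.
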